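(* Let $n\ge3$, let $\lambda_0,\ldots,\lambda_{n-1}\in\mathbb{R}$, and suppose that $P^\lambda$ is the transition matrix of a globally reversible involutive walk on $\{0,\ldots,n-1\}$ in which $0$ is accessible from every state. Then $\lambda_0=1$. Let $\mu=\lambda_1$ and $\nu=\lambda_2$. One of the following cases applies. (i) If $\nu>\mu^2$ then $\mu>\nu$ and the unique $a,b\in\mathbb{R}$ with $a,b>-1$ such that $P^\lambda=P(\gamma^{(a,b)})$ are $a(\mu,\nu)$ and $b(\mu,\nu)$. (ii) If $\nu=\mu^2$ then $\mu<1$ and $P^\lambda=P(\gamma^{(c)})$ where $c=(1-\mu)/\mu$. (iii) If $\nu_{n-1}(\mu)<\nu<\mu^2$ then the unique $a',b'\in\mathbb{R}$ with $a',b'>1$ such that $P^\lambda=P(\delta^{(a',b')})$ are $-a(\mu,\nu)$ and $-b(\mu,\nu)$, and $n\le\min(\lceil a'\rceil,\lceil b'\rceil)$. (iv) Otherwise, $\mu>\frac12$, $\nu=\nu_m(\mu)$ for a unique integer $m$ with $2\le m\le n-1$, this $m$ satisfies $m\ge\lfloor\frac{1-\mu}{\mu}(n-2)\rfloor+2$, and the unique $a'\in\mathbb{R}$ with $a'>1$ such that $P^\lambda=P(\delta^{(a',m)})$ is $a'_m(\mu)$. Moreover $n\le\lceil a'_m(\mu)\rceil$ and $P(\delta^{(a',m)})$ has exactly $m$ non-zero anti-diagonal bands, where $m<n$.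
   Context: Rows and columns of matrices are numbered from $0$. Let $B(n)_{xy}=\binom{x}{y}$ be the $n\times n$ Pascal matrix, and $J(n)$ the $n\times n$ matrix with $J(n)_{xy}=1$ if $x+y=n-1$ and $0$ otherwise. Define $H^\lambda=B(n)\,\mathrm{Diag}(\lambda_0,\ldots,\lambda_{n-1})\,B(n)^{-1}$ and $P^\lambda=H^\lambda J(n)$. An involutive walk on $\{0,\ldots,n-1\}$ is a Markov chain in which from state $x$ one chooses $y\in\{0,\ldots,x\}$ according to some probability distribution depending on $x$ and then steps to $n-1-y$; equivalently its transition matrix $P$ is stochastic with $P_{xz}=0$ whenever $x+z<n-1$. The walk is reversible if there is a strictly positive probability distribution $\pi$ with $\pi_xP_{xz}=\pi_zP_{zx}$ for all $x,z$. It is globally reversible if for every $1\le m\le n$ the top-right $m\times m$ submatrix of $P$ (rows $0,\ldots,m-1$, columns $n-m,\ldots,n-1$, relabelled $0,\ldots,m-1$) is the transition matrix of a reversible involutive walk on $\{0,\ldots,m-1\}$. Binomial coefficients are $\binom{r}{d}=r(r-1)\cdots(r-d+1)/d!$ for $r\in\mathbb{R}$, $d\in\mathbb{N}_0$. For $0\le y\le x\le n-1$ define $\gamma^{(a,b)}_{[y,x]}=\binom{y+a}{y}\binom{b+x-y}{x-y}$ for $a,b>-1$, $\gamma^{(c)}_{[y,x]}=\binom{x}{y}c^{x-y}$ for $c>0$, and $\delta^{(a',b')}_{[y,x]}=\binom{a'-1}{y}\binom{b'-1}{x-y}$ for $a',b'>1$, where $\delta^{(a',b')}$ is considered as a weight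 on $\{0,\ldots,n-1\}$ only when $n\le\min(\lceil a'\rceil,\lceil b'\rceil)$ if $b'\notin\mathbb{N}$, and only when $n\le\lceil a'\rceil$ if $b'\in\mathbb{N}$. For each such function $\gamma$, $P(\gamma)$ is the $n\times n$ matrix with $P(\gamma)_{xz}=\gamma_{[n-1-z,x]}/\sum_{y=0}^x\gamma_{[y,x]}$ if $x+z\ge n-1$ and $0$ otherwise. Its $k$th anti-diagonal band ($k=0,\ldots,n-1$) consists of the entries with $x+z=n-1+k$; a band is non-zero if its entries are non-zero. Further, for $\nu\neq\mu^2$, $$a(\mu,\nu)=\frac{\mu(\mu-\nu)}{\nu-\mu^2}-1,\qquad b(\mu,\nu)=\frac{(1-\mu)(\mu-\nu)}{\nu-\mu^2}-1,$$ and for integers $m\ge2$, $$\nu_m(\mu)=\frac{\mu(m\mu-1)}{m-2+\mu},\qquad a'_m(\mu)=\frac{(m-2)\mu+1}{1-\mu}.$$ *)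

(* Defs.v *)
From mathcomp Require Import all_boot all_order all_algebra.
From mathcomp Require Import reals.

Set Implicit Arguments.
Unset Strict Implicit.
Unset Printing Implicit Defensive.
Import Order.TTheory GRing.Theory Num.Theory.
Local Open Scope ring_scope.

(* Rows and columns are numbered from 0, so states are elements of 'I_n.      *)

Definition pascal_mx (R : realType) (n : nat) : 'M[R]_n :=
  \matrix_(x, y) 'C(x, y)%:R.

Definition antidiag_mx (R : realType) (n : nat) : 'M[R]_n :=
  \matrix_(x, y) (x + y == n.-1)%N%:R.

Definition H_mx (R : realType) (n : nat) (lam : n.-tuple R) : 'M[R]_n :=
  pascal_mx R n *m diag_mx (\row_i tnth lam i) *m invmx (pascal_mx R n).

Definition P_mx (R : realType) (n : nat) (lam : n.-tuple R) : 'M[R]_n :=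
  H_mx lam *m antidiag_mx R n.

Definition stochastic (R : realType) (n : nat) (P : 'M[R]_n) : Prop :=
  (forall x z, 0 <= P x z) /\ (forall x, \sum_z P x z = 1).

(* Stepping from x to n-1-y with y <= x is stepping to z with x + z >= n-1.   *)
Definition involutive_walk (R : realType) (n : nat) (P : 'M[R]_n) : Prop :=
  stochastic P /\ (forall x z : 'I_n, (x + z < n.-1)%N -> P x z = 0).

Definition reversible (R : realType) (n : nat) (P : 'M[R]_n) : Prop :=
  exists pi : 'I_n -> R,
    [/\ forall x, 0 < pi x, \sum_x pi x = 1
      & forall x z, pi x * P x z = pi z * P z x].

(* Rows 0, ..., m-1 and columns n-m, ..., n-1.                                *)
Definition top_right_mx (R : realType) (n m : nat) (le_mn : (m <= n)%N)
    (P : 'M[R]_n) : 'M[R]_m :=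
  mxsub (widen_ord le_mn)
        (fun z : 'I_m => cast_ord (subnK le_mn) (rshift (n - m) z)) P.

Definition globally_reversible (R : realType) (n : nat) (P : 'M[R]_n) : Prop :=
  forall (m : nat) (le_mn : (m <= n)%N), (1 <= m)%N ->
    involutive_walk (top_right_mx le_mn P) /\
    reversible (top_right_mx le_mn P).

Definition accessible (R : realType) (n : nat) (P : 'M[R]_n)
    (x z : 'I_n) : Prop :=
  exists k : nat, 0 < (P ^+ k) x z.

Definition rbinom (R : realType) (r : R) (d : nat) : R :=
  (\prod_(i < d) (r - i%:R)) / d`!%:R.

(* A weight g is written as a function of y and x, in the order of g_[y,x].   *)

Definition gamma_ab (R : realType) (a b : R) (y x : nat) : R :=
  rbinom (y%:R + a) y * rbinom (b + (x - y)%:R) (x - y).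

Definition gamma_c (R : realType) (c : R) (y x : nat) : R :=
  'C(x, y)%:R * c ^+ (x - y).

Definition delta (R : realType) (a' b' : R) (y x : nat) : R :=
  rbinom (a' - 1) y * rbinom (b' - 1) (x - y).

(* The condition under which delta a' b' is considered on {0, ..., n-1}.      *)
Definition delta_weight (R : realType) (n : nat) (a' b' : R) : Prop :=
  [/\ 1 < a', 1 < b'
    & if b' \is a Num.nat then n%:Z <= Num.ceil a'
      else n%:Z <= Num.min (Num.ceil a') (Num.ceil b')].

Definition weight_mx (R : realType) (n : nat) (g : nat -> nat -> R) : 'M[R]_n :=
  \matrix_(x, z)
    if (n.-1 <= x + z)%N then g (n.-1 - z)%N x / \sum_(y < x.+1) g y x else 0.

(* The k-th band consists of the entries with x + z = n-1+k.                  *)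
Definition nonzero_band (R : realType) (n : nat) (P : 'M[R]_n) (k : nat) :
    bool :=
  [forall x : 'I_n, forall z : 'I_n,
    (x + z == n.-1 + k)%N ==> (P x z != 0)].

Definition num_nonzero_bands (R : realType) (n : nat) (P : 'M[R]_n) : nat :=
  #|[set k : 'I_n | nonzero_band P k]|.

Definition a_par (R : realType) (mu nu : R) : R :=
  mu * (mu - nu) / (nu - mu ^+ 2) - 1.

Definition b_par (R : realType) (mu nu : R) : R :=
  (1 - mu) * (mu - nu) / (nu - mu ^+ 2) - 1.

Definition nu_par (R : realType) (m : nat) (mu : R) : R :=
  mu * (m%:R * mu - 1) / (m%:R - 2 + mu).

Definition a'_par (R : realType) (m : nat) (mu : R) : R :=
  ((m%:R - 2) * mu + 1) / (1 - mu).

(* Main.v *)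
Require Import Defs.
From mathcomp Require Import all_boot all_order all_algebra.
From mathcomp Require Import reals.
From mathcomp Require Import ring lra zify.

Set Implicit Arguments.
Unset Strict Implicit.
Unset Printing Implicit Defensive.
Import Order.TTheory GRing.Theory Num.Theory.
Local Open Scope ring_scope.

(* Write H = B Diag(lam) B^-1. Its entries are H_xy = C(x,y) d_(x-y)(y), where
   d_0 = lam and d_(k+1)(y) = d_k(y) - d_k(y+1). Kolmogorov's criterion on the
   submatrices shows that each band {d_k(y)}_y vanishes identically or
   nowhere, and on the cycle 1, w+2, 2, w+1 of the walk on {0,...,w+2} it forces
   lam_y / (lam_y - lam_(y+1)) to be an arithmetic progression in y, that is
     lam_(y+1) / lam_y = (mu + t y) / (1 + t y),  t = (nu - mu^2) / (mu - nu).
   Hence d_k(y) = prod_(i<y) (mu + t i) prod_(i<k) (1 - mu + t i) /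
   prod_(i<y+k) (1 + t i), the probabilities of a Polya urn, which are the
   weights gamma^(a,b), gamma^(c) or delta^(a',b') according to the sign of t. For t < 0
   the condition d_k(0) >= 0 lets the factor 1 - mu + t i change sign only by
   passing through 0 at some i = m-1, which is the case nu = nu_m(mu). *)

(** * Iterated differences and the entries of [H] and [P] *)

Fixpoint bdiff (R : zmodType) (l : nat -> R) (k y : nat) : R :=
  if k is k'.+1 then bdiff l k' y - bdiff l k' y.+1 else l y.

(** With [E] the shift and [D = 1 - E], this expands [(D + E)^N = 1], applied to [l] at [y]. *)
Lemma sum_bin_bdiff (R : pzRingType) (l : nat -> R) (N y : nat) :
  \sum_(j < N.+1) 'C(N, j)%:R * bdiff l (N - j) (y + j) = l y.
Proof.
elim: N y => [|N IH] y; first by rewrite big_ord1 bin0 mul1r addn0.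
rewrite big_ord_recl /= bin0 mul1r addn0.
under eq_bigr => j _ do rewrite binS natrD mulrDl.
rewrite big_split /= addrA big_ord_recr /= bin_small // mul0r addr0.
have -> : bdiff l N y - bdiff l N y.+1 +
    \sum_(i < N) 'C(N, i.+1)%:R * bdiff l (N.+1 - i.+1) (y + i.+1) =
    \sum_(j < N.+1) 'C(N, j)%:R * bdiff l (N - j).+1 (y + j).
  rewrite [RHS]big_ord_recl bin0 mul1r subn0 addn0; congr (_ + _).
  by apply: eq_bigr => i _; rewrite /= subSn // subSS.
rewrite -big_split /= -[RHS]IH; apply: eq_bigr => j _.
by rewrite -mulrDr addnS subSS subrK.
Qed.

Lemma mul_bin_bin (x j k : nat) : (j + k <= x)%N ->
  ('C(x, k) * 'C(x - k, j) = 'C(x, j + k) * 'C(j + k, k))%N.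
Proof.
move=> le_jkx; have le_kx : (k <= x)%N := leq_trans (leq_addl j k) le_jkx.
have le_j : (j <= x - k)%N by rewrite leq_subRL // addnC.
have := bin_fact le_jkx; have := bin_fact (leq_addl j k).
have := bin_fact le_kx; have := bin_fact le_j.
rewrite addnK -subnDA [(k + j)%N]addnC => e1 e2 e3 e4.
apply/eqP; rewrite -(@eqn_pmul2r (j`! * k`! * (x - (j + k))`!)); last first.
  by rewrite !muln_gt0 !fact_gt0.
apply/eqP; transitivity x`!.
  by rewrite -e2 -e1; ring.
by rewrite -e4 -e3; ring.
Qed.

(** The left side is an entry of [L B], where [L] has entries [C(x,y) f(x-y,y)]. By [mul_bin_bin]
    the factor [C(x,k)] comes out, and for [f = bdiff l] the sum of [sum_bin_bdiff] remains. *)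
Lemma sum_bin_conv (R : comPzSemiRingType) (n x k : nat) (f : nat -> nat -> R) :
  (x < n)%N ->
  \sum_(y < n) 'C(x, y)%:R * f (x - y)%N y * 'C(y, k)%:R =
  'C(x, k)%:R * \sum_(j < (x - k).+1) 'C(x - k, j)%:R * f (x - k - j)%N (k + j)%N.
Proof.
move=> lt_xn; have [lt_xk|le_kx] := ltnP x k.
  rewrite bin_small // mul0r big1 // => y _.
  have [lt_yk|le_ky] := ltnP y k; first by rewrite (bin_small lt_yk) mulr0.
  by rewrite (bin_small (leq_trans lt_xk le_ky)) !mul0r.
rewrite -(big_mkord xpredT (fun y => 'C(x, y)%:R * f (x - y)%N y * 'C(y, k)%:R)).
rewrite (big_cat_nat (n := k)) //=; last by rewrite ltnW // (leq_ltn_trans le_kx).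
rewrite big_nat_cond big1 ?add0r; last first.
  by move=> y /andP[/andP[_ lt_yk] _]; rewrite (bin_small lt_yk) mulr0.
rewrite (big_cat_nat (n := x.+1)) //=; last by rewrite ltnW.
rewrite [X in _ + X]big_nat_cond [X in _ + X]big1 ?addr0; last first.
  by move=> y /andP[/andP[lt_xy _] _]; rewrite (bin_small lt_xy) !mul0r.
rewrite -{1}[k]add0n big_addn subSn // big_mkord big_distrr /=.
apply: eq_bigr => j _; rewrite subnDA subnAC [(k + j)%N]addnC !mulrA.
have le_jx : (j + k <= x)%N by have := ltn_ord j; lia.
rewrite -natrM mul_bin_bin // natrM.
by rewrite -!mulrA; congr (_ * _); rewrite mulrC.
Qed.

(** The binomial vanishes for [x < y], so the truncated [x - y] does no harm above the diagonal. *)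
Definition lower_entry (R : pzRingType) (l : nat -> R) (x y : nat) : R :=
  'C(x, y)%:R * bdiff l (x - y) y.

Lemma pascal_mx_unit (R : realType) (n : nat) : pascal_mx R n \in unitmx.
Proof.
rewrite unitmxE det_trig; last first.
  by apply/is_trig_mxP => i j lt_ij; rewrite mxE bin_small.
by rewrite big1 ?unitr1 // => i _; rewrite mxE binn.
Qed.

(** The inverse of [B] is never computed: the matrix [L] of the claimed entries satisfies
    [B D = L B], and [B] cancels on the right. *)
Lemma H_mxE (R : realType) (n : nat) (lam : n.-tuple R) (x y : 'I_n) :
  H_mx lam x y = lower_entry (nth 0 lam) x y.
Proof.
rewrite /H_mx; set D := diag_mx _; set B := pascal_mx R n.
have -> : B *m D = (\matrix_(i, j) lower_entry (nth 0 lam) i j) *m B.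
  apply/matrixP => i k; rewrite mul_mx_diag !mxE /lower_entry.
  under [RHS]eq_bigr => j _ do rewrite !mxE.
  by rewrite (sum_bin_conv k (bdiff (nth 0 lam))) // sum_bin_bdiff (tnth_nth 0).
by rewrite mulmxK ?pascal_mx_unit // mxE.
Qed.

Lemma P_mxE (R : realType) (n : nat) (lam : n.-tuple R) (x z : 'I_n) :
  P_mx lam x z = lower_entry (nth 0 lam) x (n.-1 - z).
Proof.
have lt_zn : (n.-1 - z < n)%N by have := ltn_ord z; lia.
rewrite !mxE (bigD1 (Ordinal lt_zn)) //= H_mxE mxE /= subnK; last first.
  by have := ltn_ord z; lia.
rewrite eqxx mulr1 big1 ?addr0 // => j ne_j.
rewrite [antidiag_mx _ _ _ _]mxE; have [e|_] := eqVneq; last by rewrite mulr0.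
by case/eqP: ne_j; apply: val_inj => /=; lia.
Qed.

(** Column [z] of the block is column [n-m+z] of [P], hence column [m-1-z] of [H]. Every block thus
    has the shape of [P] itself, with the same sequence [lam]. *)
Lemma top_right_mxE (R : realType) (n m : nat) (le_mn : (m <= n)%N)
    (lam : n.-tuple R) (x z : 'I_m) :
  top_right_mx le_mn (P_mx lam) x z = lower_entry (nth 0 lam) x (m.-1 - z).
Proof.
rewrite mxE P_mxE /=; congr lower_entry.
by have := ltn_ord z; lia.
Qed.

(** * Consequences of global reversibility *)

(** Indices in [nat] let one formula serve the blocks of all sizes. *)
Definition balanced (R : pzRingType) (l : nat -> R) (m : nat) (pi : nat -> R) :=
  forall x z, (x < m)%N -> (z < m)%N ->
    pi x * lower_entry l x (m.-1 - z) = pi z * lower_entry l z (m.-1 - x).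

Lemma globally_reversible_balanced (R : realType) (n : nat) (lam : n.-tuple R) :
  globally_reversible (P_mx lam) ->
  forall m, (0 < m <= n)%N -> exists2 pi : nat -> R,
    forall x, (x < m)%N -> 0 < pi x & balanced (nth 0 lam) m pi.
Proof.
move=> hrev [|m] // /andP[_ le_mn];
have [_ [pi [pi_gt0 _ pi_rev]]] := hrev _ le_mn isT.
exists (fun x => pi (inord x)) => [x _|x z lt_x lt_z]; first exact: pi_gt0.
by have := pi_rev (inord x) (inord z); rewrite !top_right_mxE !inordK.
Qed.

Lemma globally_reversible_ge0 (R : realType) (n : nat) (lam : n.-tuple R) :
  globally_reversible (P_mx lam) ->
  forall k y, (k + y < n)%N -> 0 <= bdiff (nth 0 lam) k y.
Proof.
move=> hrev k y lt_n; have [[[P_ge0 _] _] _] := hrev _ lt_n isT.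
(* In the block of [k + y + 1] states, column [k] of [P] is column [y] of [H]. *)
have := P_ge0 (inord (k + y)) (inord k); rewrite top_right_mxE !inordK; [|lia..].
by rewrite /lower_entry /= addKn addnK pmulr_rge0 // ltr0n bin_gt0 leq_addl.
Qed.

(** The block with [m = 1] has the single entry [lam_0], which is its row sum. *)
Lemma globally_reversible_0 (R : realType) (n : nat) (lam : n.-tuple R) :
  (0 < n)%N -> globally_reversible (P_mx lam) -> lam`_0 = 1.
Proof.
move=> n_gt0 hrev; have [[[_ P_sum] _] _] := hrev 1 n_gt0 isT.
by have := P_sum ord0; rewrite big_ord1 top_right_mxE /lower_entry /= mul1r.
Qed.

Lemma mul_bin2_sub w : (w.+2 * w.+1 = 2 * 'C(w.+2, w))%N.
Proof.
by rewrite -bin_sub ?leqW // -addn2 addKn (mul_bin_left (w + 2) 1) bin1 subn1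
  mulnC addn2.
Qed.

(** * Products over arithmetic progressions *)

(** For [s = 1] this is the rising factorial. Allowing any step covers powers ([s = 0]) and falling
    products ([s < 0]) by the same formulas. *)
Definition rising (R : pzRingType) (p s : R) (k : nat) :=
  \prod_(i < k) (p + s * i%:R).

Lemma rising0 (R : pzRingType) (p s : R) : rising p s 0 = 1.
Proof. exact: big_ord0. Qed.

Lemma risingS (R : pzRingType) (p s : R) (k : nat) :
  rising p s k.+1 = rising p s k * (p + s * k%:R).
Proof. exact: big_ord_recr. Qed.

Lemma rising_gt0 (R : numDomainType) (p s : R) (k : nat) :
  (forall i, (i < k)%N -> 0 < p + s * i%:R) -> 0 < rising p s k.
Proof. by move=> pos; apply: prodr_gt0 => i _; apply: pos. Qed.

(** * The recursion for [l] and the closed form of its differences *)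

Section Recursion.
Variables (R : realFieldType) (n : nat) (l : nat -> R).
Hypothesis l_ge0 : forall k y, (k + y < n)%N -> 0 <= bdiff l k y.
Hypothesis l0 : l 0 = 1.
Hypothesis l_bal : forall m, (0 < m <= n)%N -> exists2 pi : nat -> R,
  forall x, (x < m)%N -> 0 < pi x & balanced l m pi.

(** Detailed balance between [k] and [k + y] in the block of size [k + y + 1] reads
    [pi_k d_k(0) = pi_(k+y) C(k+y,y) d_k(y)], and the other factors are positive. *)
Lemma band_dichotomy k y : (k + y < n)%N ->
  (bdiff l k y == 0) = (bdiff l k 0 == 0).
Proof.
move=> lt_n; have [|pi pi_gt0 pi_rev] := l_bal (m := (k + y).+1); first by lia.
have := pi_rev k (k + y)%N; rewrite /lower_entry /= subnn addKn addnK subn0 bin0.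
move=> /(_ ltac:(lia) ltac:(lia)) e.
have c_gt0 : 0 < 'C(k + y, y)%:R :> R by rewrite ltr0n bin_gt0 leq_addl.
have p1 := pi_gt0 k ltac:(lia); have p2 := pi_gt0 (k + y)%N ltac:(lia).
apply/eqP/eqP => d0; move/eqP: e; rewrite d0 !mulr0 ?mulf_eq0.
  by rewrite oner_eq0 (gt_eqF p1) /= => /eqP.
by rewrite eq_sym !mulf_eq0 (gt_eqF p2) (gt_eqF c_gt0) /= => /eqP.
Qed.

Lemma band_gt0 k y : (k + y < n)%N -> bdiff l k 0 != 0 -> 0 < bdiff l k y.
Proof. by move=> lt_n d0; rewrite lt_def l_ge0 // band_dichotomy // d0. Qed.

Lemma l_gt0 y : (y < n)%N -> 0 < l y.
Proof. by move=> lt_n; apply: (@band_gt0 0) => //=; rewrite l0 oner_eq0. Qed.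

(* The 4-cycle 1, w+2, 2, w+1 in Kolmogorov's criterion for the walk on
   {0, ..., w+2}. *)
Lemma kolmogorov_cycle w : (w.+2 < n)%N ->
  bdiff l 1 0 * bdiff l 1 1 * bdiff l 2 w * l w.+1 =
  bdiff l 1 w.+1 * bdiff l 1 w * bdiff l 2 0 * l 1.
Proof.
move=> lt_n; have [|pi pi_gt0 pi_rev] := l_bal (m := w.+3); first by lia.
have e1 := pi_rev 1%N w.+2 isT ltac:(lia).
have e2 := pi_rev 2%N w.+2 isT ltac:(lia).
have e3 := pi_rev 1%N w.+1 isT ltac:(lia).
have e4 := pi_rev 2%N w.+1 isT ltac:(lia).
have p1 := pi_gt0 1%N isT; have p2 := pi_gt0 2%N isT.
have p3 := pi_gt0 w.+2 ltac:(lia); have p4 := pi_gt0 w.+1 ltac:(lia).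
move: e1 e2 e3 e4; rewrite /lower_entry /= !subSS !subn0 !subnn.
rewrite (_ : w.+1 - w = 1)%N; last lia.
rewrite (_ : w.+2 - w = 2)%N; last lia.
rewrite !bin0 !binn !bin1 (binSn w.+1) (binSn w) /=.
(* Around the cycle the binomials multiply to [2 C(w+2,w)] in one direction and [(w+2)(w+1)] in the
   other, so they cancel. *)
have := mul_bin2_sub w.
move/(congr1 (fun k => k%:R : R)); rewrite !natrM.
set c := 'C(_, _)%:R.
move=> ec e1 e2 e3 e4.
have ne : pi 1%N * pi 2%N * pi w.+2 * pi w.+1 * (w.+2%:R * w.+1%:R) != 0 :> R.
  by rewrite !mulf_neq0 ?gt_eqF // ltr0n.
apply: (mulfI ne); rewrite {1}ec.
transitivity ((pi 1%N * (1 * (l 0 - l 1))) *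
  (pi w.+2 * (c * (l w - l w.+1 - (l w.+1 - l w.+2)))) *
  (pi w.+1 * (1 * l w.+1)) * (pi 2%N * (2%:R * (l 1%N - l 2%N)))); first by ring.
rewrite e1 -e2 -e3 e4; ring.
Qed.

Hypothesis n_ge3 : (2 < n)%N.
Hypothesis l1_lt1 : l 1 < 1.

Let mu := l 1.
Let nu := l 2.
Let t := (nu - mu ^+ 2) / (mu - nu).

Lemma bdiff1_gt0 y : (y.+1 < n)%N -> 0 < bdiff l 1 y.
Proof.
move=> lt_n; apply: band_gt0; rewrite ?add1n //= l0.
by rewrite subr_eq0 (gt_eqF l1_lt1).
Qed.

Lemma l2_lt_l1 : nu < mu.
Proof. by rewrite -subr_gt0; apply: (@bdiff1_gt0 1%N). Qed.

(* Equivalently, l y / bdiff l 1 y is an arithmetic progression. *)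
Lemma bdiff1E y : (y.+1 < n)%N ->
  bdiff l 1 y * (1 + t * y%:R) = (1 - mu) * l y.
Proof.
have d_neq0 : mu - nu != 0 by rewrite subr_eq0 (gt_eqF l2_lt_l1).
elim: y => [|w IH] lt_n; first by rewrite /= l0 mulr0 addr0 -/mu.
have {}IH := IH (ltnW lt_n).
have := kolmogorov_cycle lt_n; have := bdiff1_gt0 (ltnW lt_n); have := bdiff1_gt0 lt_n.
have -> : bdiff l 2 w = bdiff l 1 w - bdiff l 1 w.+1 by [].
have lE : l w.+1 = l w - bdiff l 1 w by rewrite /=; ring.
have -> : bdiff l 2 0 = 1 - 2%:R * mu + nu by rewrite /= l0 -/mu -/nu; ring.
have -> : bdiff l 1 0 = 1 - mu by rewrite /= l0.
have -> : bdiff l 1 1 = mu - nu by [].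
rewrite -/mu; move: IH lE.
set e := bdiff l 1 w; set f := bdiff l 1 w.+1; set L := l w.+1 => IH lE f_gt0 e_gt0 cyc.
have e_neq0 : e != 0 by rewrite gt_eqF.
have {}lE : l w = L + e by rewrite lE subrK.
rewrite {}lE in IH.
have tE : t * (mu - nu) = nu - mu ^+ 2 by rewrite /t mulfVK.
(* Divided by [(1-mu)(mu-nu)ef], the cycle identity says that [L/f - L/e] is constant. As
   [L/e = l w / e - 1], the ratio [l y / bdiff l 1 y] grows by [t/(1-mu)] from [w] to [w+1].
   Multiplying the goal by [(mu-nu)e] avoids these divisions. *)
apply: (mulfI (mulf_neq0 d_neq0 e_neq0)); apply/eqP; rewrite -subr_eq0; apply/eqP.
have -> : (mu - nu) * e * (f * (1 + t * w.+1%:R)) - (mu - nu) * e * ((1 - mu) * L) =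
  (mu - nu) * f * (e * (1 + t * w%:R)) + f * e * (t * (mu - nu)) -
  (mu - nu) * e * ((1 - mu) * L) by rewrite -natr1; ring.
move/eqP: cyc; rewrite IH tE -subr_eq0 => /eqP cyc.
rewrite -[X in _ = X]oppr0 -[in X in _ = X]cyc; ring.
Qed.

Lemma lS_t y : (y.+1 < n)%N -> l y.+1 * (1 + t * y%:R) = l y * (mu + t * y%:R).
Proof.
move=> lt_n; have := bdiff1E lt_n; rewrite /= mulrBl => e.
by rewrite -[LHS](subKr (l y * (1 + t * y%:R))) e; ring.
Qed.

Lemma one_t_gt0 y : (y.+1 < n)%N -> 0 < 1 + t * y%:R.
Proof.
move=> lt_n; rewrite -(pmulr_rgt0 _ (bdiff1_gt0 lt_n)) bdiff1E //.
by rewrite mulr_gt0 ?subr_gt0 // l_gt0 // ltnW.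
Qed.

(** The sign is read off [lS_t]. For [t < 0] the instance [y = n-2] becomes the bound
    [n - 1 < a']. *)
Lemma mu_t_gt0 y : (y.+1 < n)%N -> 0 < mu + t * y%:R.
Proof.
move=> lt_n; rewrite -(pmulr_rgt0 _ (l_gt0 (ltnW lt_n))) -lS_t //.
by rewrite mulr_gt0 ?one_t_gt0 // l_gt0.
Qed.

Lemma rising1_gt0 x : (x < n)%N -> 0 < rising 1 t x.
Proof.
by move=> lt_n; apply: rising_gt0 => i lt_i; apply: one_t_gt0; apply: leq_ltn_trans lt_n.
Qed.

Lemma rising_mu_gt0 x : (x < n)%N -> 0 < rising mu t x.
Proof.
by move=> lt_n; apply: rising_gt0 => i lt_i; apply: mu_t_gt0; apply: leq_ltn_trans lt_n.
Qed.

(** For [k = 0] this is the product of the ratios in [lS_t]. In the step from [k] to [k+1] the new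
    factor is [(1 + t(k+y)) - (mu + ty) = 1 - mu + tk], independent of [y]. *)
Lemma bdiff_rising k y : (k + y < n)%N ->
  bdiff l k y * rising 1 t (k + y) = rising mu t y * rising (1 - mu) t k.
Proof.
elim: k y => [|k IH] y.
  rewrite add0n /= rising0 mulr1; elim: y => [|y IH] lt_n.
    by rewrite !rising0 l0 mulr1.
  by rewrite !risingS -IH 1?ltnW // mulrCA lS_t //; ring.
move=> lt_n; have e1 := IH y (ltnW lt_n); have e2 := IH y.+1; rewrite addnS in e2.
rewrite addSn /= mulrBl (e2 lt_n) !risingS [bdiff l k y * _]mulrA e1 natrD; ring.
Qed.

Lemma rising_compl_ge0 k : (k < n)%N -> 0 <= rising (1 - mu) t k.
Proof.
move=> lt_n; have := @bdiff_rising k 0; rewrite addn0 rising0 mul1r => <- //.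
by rewrite mulr_ge0 ?l_ge0 ?addn0 // ltW // rising1_gt0.
Qed.

Lemma lower_entry_rising x y : (y <= x < n)%N ->
  lower_entry l x y * rising 1 t x =
  'C(x, y)%:R * (rising mu t y * rising (1 - mu) t (x - y)).
Proof.
by move=> /andP[le_yx lt_n]; rewrite /lower_entry -mulrA -bdiff_rising subnK.
Qed.

(** Only the factor depending on [x - y] can vanish, so zeros fill whole bands. *)
Lemma lower_entry_eq0 x y : (y <= x < n)%N ->
  (lower_entry l x y == 0) = (rising (1 - mu) t (x - y) == 0).
Proof.
move=> le_yxn; have /andP[le_yx lt_n] := le_yxn.
have /(congr1 (fun r => r == 0)) := lower_entry_rising le_yxn.
rewrite !mulf_eq0 (gt_eqF (rising1_gt0 lt_n)) orbF => ->.
by rewrite pnatr_eq0 -leqn0 leqNgt bin_gt0 le_yx (gt_eqF (rising_mu_gt0 _)) //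
  (leq_ltn_trans le_yx).
Qed.
End Recursion.

(** * Row normalisation and accessibility *)

(** The all-ones vector is column 0 of [B], so it is an eigenvector of [H] for [lam_0]. *)
Lemma sum_lower_entry (R : pzRingType) (l : nat -> R) (x : nat) :
  \sum_(y < x.+1) lower_entry l x y = l 0.
Proof. by rewrite -[RHS](sum_bin_bdiff l x). Qed.

(** Normalising the rows of [g] removes [kappa], and the rows of [H] already sum to [lam_0 = 1]. *)
Lemma P_mx_weight (R : realType) (n : nat) (lam : n.-tuple R)
    (g : nat -> nat -> R) (kappa : nat -> R) :
  lam`_0 = 1 -> (forall x, (x < n)%N -> kappa x != 0) ->
  (forall x y, (y <= x < n)%N -> g y x = kappa x * lower_entry (nth 0 lam) x y) ->
  P_mx lam = weight_mx n g.
Proof.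
move=> lam0 k_neq0 gE; apply/matrixP => x z; rewrite P_mxE mxE.
have := ltn_ord x; have := ltn_ord z => lt_z lt_x.
case: leqP => [le_n|lt_n]; last by rewrite /lower_entry bin_small ?mul0r //; lia.
rewrite gE; last by lia.
rewrite (eq_bigr (fun y : 'I_x.+1 => kappa x * lower_entry (nth 0 lam) x y)); last first.
  by move=> y _; rewrite gE // lt_x -ltnS ltn_ord.
rewrite -mulr_sumr sum_lower_entry lam0 mulr1 mulrC mulKf //.
exact: k_neq0.
Qed.

(** If [lam_1 = 1] then [d_1(0) = 0], so by [band_dichotomy] all differences of positive order
    vanish and [P] lives on [x + z = n-1]. From state 1 only 1 and [n-2] are then reached, and
    neither is 0 since [n >= 3]. *)
Lemma accessible_l1_lt1 (R : realType) (n : nat) (lam : n.-tuple R) :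
  (2 < n)%N -> globally_reversible (P_mx lam) ->
  (forall x z : 'I_n, z = 0%N :> nat -> accessible (P_mx lam) x z) ->
  lam`_1 < 1.
Proof.
move=> n_ge3 hrev hacc; set l := nth 0 lam.
have l0 : l 0 = 1 by apply: globally_reversible_0 (ltnW (ltnW n_ge3)) hrev.
have l_ge0 := globally_reversible_ge0 hrev.
have l_bal := globally_reversible_balanced hrev.
rewrite lt_neqAle -[X in _ && (_ <= X)]l0 -subr_ge0 (l_ge0 1 0)%N ?andbT; last by lia.
apply/negP => /eqP l1.
have d1 y : (y.+1 < n)%N -> bdiff l 1 y = 0.
  move=> lt_n; apply/eqP; rewrite (band_dichotomy l_bal) //.
  by rewrite -[bdiff _ _ _]/(l 0 - l 1%N) l0 l1 subrr.
have dk k y : (k.+1 + y < n)%N -> bdiff l k.+1 y = 0.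
  elim: k y => [|k IH] y lt_n; first exact: d1.
  have -> : bdiff l k.+2 y = bdiff l k.+1 y - bdiff l k.+1 y.+1 by [].
  by rewrite !IH ?subrr //; lia.
have P0 (w z : 'I_n) : (w + z != n.-1)%N -> P_mx lam w z = 0.
  move=> ne; rewrite P_mxE /lower_entry; have := ltn_ord z; have := ltn_ord w => lt_w lt_z.
  have [lt|le] := ltnP w (n.-1 - z); first by rewrite bin_small ?mul0r.
  have lt : (n.-1 - z < w)%N by lia.
  rewrite (_ : w - (n.-1 - z) = (w - (n.-1 - z)).-1.+1)%N; last by lia.
  by rewrite dk ?mulr0 //; lia.
have lt1n : (1 < n)%N by lia.
pose x1 := Ordinal lt1n.
have Pk k : forall z : 'I_n, z != 1%N :> nat -> z != n.-2 :> nat ->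
    (P_mx lam ^+ k) x1 z = 0.
  elim: k => [|k IH] z z1 z2.
    by rewrite expr0 mxE -val_eqE eq_sym (negPf z1).
  rewrite exprSr mxE big1 // => w _.
  have [w1|w1] := eqVneq (w : nat) 1%N; first by rewrite (P0 w) ?mulr0 //; lia.
  have [w2|w2] := eqVneq (w : nat) n.-2; first by rewrite (P0 w) ?mulr0 //; lia.
  by rewrite IH ?mul0r.
have lt0n : (0 < n)%N by lia.
have [k] := hacc x1 (Ordinal lt0n) erefl.
by rewrite Pk ?ltxx //=; lia.
Qed.

(** * Generalised binomials as rising products *)

(** Reversing the factors turns [y + r - i] into [r + 1 + i]; each is then scaled by [s], which will
    be [t]. *)
Lemma rbinom_rising (R : realType) (r s : R) (y : nat) : s != 0 ->
  rbinom (y%:R + r) y = rising ((r + 1) * s) s y / (s ^+ y * y`!%:R).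
Proof.
move=> s_neq0; rewrite /rbinom /rising invfM mulrA; congr (_ * _).
apply: canRL (mulfK (expf_neq0 _ s_neq0)) _.
rewrite (reindex_inj rev_ord_inj) /= -[y in s ^+ y]card_ord -prodr_const -big_split /=.
apply: eq_bigr => i _; rewrite natrB ?ltn_ord // -natr1; ring.
Qed.

Lemma rbinom_falling (R : realType) (r s : R) (y : nat) : s != 0 ->
  rbinom r y = rising (- (r * s)) s y / ((- s) ^+ y * y`!%:R).
Proof.
move=> s_neq0; rewrite /rbinom /rising invfM mulrA; congr (_ * _).
apply: canRL (mulfK (expf_neq0 _ _)) _; first by rewrite oppr_eq0.
rewrite -[y in _ ^+ y]card_ord -prodr_const -big_split /=.
by apply: eq_bigr => i _; ring.
Qed.

Lemma natr_fact_neq0 (R : numDomainType) (k : nat) : k`!%:R != 0 :> R.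
Proof. by rewrite pnatr_eq0 -lt0n fact_gt0. Qed.

Lemma natr_bin (R : numFieldType) (x y : nat) : (y <= x)%N ->
  'C(x, y)%:R = x`!%:R / (y`!%:R * (x - y)`!%:R) :> R.
Proof.
move=> le_yx; rewrite -(bin_fact le_yx) !natrM mulfK //.
by rewrite mulf_neq0 ?natr_fact_neq0.
Qed.

(** This is the shape required by [P_mx_weight]: a factor depending on the row [x] only, times an
    urn numerator. For [s = t] the parameters are chosen so that the products start at [mu] and
    [1 - mu]; [deltaE] serves [t < 0] in the same way. *)
Lemma gamma_abE (R : realType) (a b s : R) (x y : nat) : s != 0 -> (y <= x)%N ->
  gamma_ab a b y x = (s ^+ x * x`!%:R)^-1 *
    ('C(x, y)%:R * (rising ((a + 1) * s) s y * rising ((b + 1) * s) s (x - y))).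
Proof.
move=> s_neq0 le_yx; rewrite /gamma_ab [b + _]addrC !(rbinom_rising _ _ s_neq0) natr_bin //.
have -> : s ^+ x = s ^+ y * s ^+ (x - y) by rewrite -exprD subnKC.
field.
by rewrite !natr_fact_neq0 !expf_neq0.
Qed.

Lemma deltaE (R : realType) (a b s : R) (x y : nat) : s != 0 -> (y <= x)%N ->
  delta a b y x = ((- s) ^+ x * x`!%:R)^-1 *
    ('C(x, y)%:R * (rising (- ((a - 1) * s)) s y * rising (- ((b - 1) * s)) s (x - y))).
Proof.
move=> s_neq0 le_yx; rewrite /delta !(rbinom_falling _ _ s_neq0) natr_bin //.
have : - s != 0 by rewrite oppr_eq0.
move: (- s) => u u_neq0.
have -> : u ^+ x = u ^+ y * u ^+ (x - y) by rewrite -exprD subnKC.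
field.
by rewrite !natr_fact_neq0 !expf_neq0.
Qed.

(** * Recovering the parameters from [lam_1] and [lam_2] *)

(** The diagonal of [H] is [lam], and it is band 0 of [P]. *)
Lemma weight_mx_diag (R : realType) (n : nat) (lam : n.-tuple R)
    (g : nat -> nat -> R) (j : nat) :
  (j < n)%N -> P_mx lam = weight_mx n g -> lam`_j = g j j / \sum_(y < j.+1) g y j.
Proof.
move=> lt_n /matrixP e; have lt' : (n.-1 - j < n)%N by lia.
have := e (Ordinal lt_n) (Ordinal lt'); rewrite P_mxE mxE /= subKn; last by lia.
rewrite /lower_entry binn subnn mul1r /= => ->.
by rewrite ifT //; lia.
Qed.

Lemma rbinom0 (R : realType) (r : R) : rbinom r 0 = 1.
Proof. by rewrite /rbinom big_ord0 divr1. Qed.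

Lemma rbinom1 (R : realType) (r : R) : rbinom r 1 = r.
Proof. by rewrite /rbinom big_ord1 subr0 divr1. Qed.

Lemma rbinom2 (R : realType) (r : R) : rbinom r 2 = r * (r - 1) / 2.
Proof. by rewrite /rbinom !big_ord_recl big_ord0 /= subr0 mulr1. Qed.

(** Rows 1 and 2 give [mu = (a+1)/(a+b+2)] and [nu = mu (a+2)/(a+b+3)], which are solved for [a] and
    [b]. *)
Lemma gamma_ab_inj (R : realType) (n : nat) (lam : n.-tuple R) (a b : R) :
  let mu := lam`_1 in let nu := lam`_2 in
  (2 < n)%N -> -1 < a -> -1 < b ->
  P_mx lam = weight_mx n (gamma_ab a b) ->
  (a_par mu nu, b_par mu nu) = (a, b).
Proof.
move=> mu nu n_ge3 a_gt b_gt e.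
have := weight_mx_diag (ltnW n_ge3) e; have := weight_mx_diag n_ge3 e.
rewrite -/mu -/nu !big_ord_recr !big_ord0 /= /gamma_ab /= !rbinom0 !rbinom1 !rbinom2.
rewrite ?subn0 ?subn1 /= => nuE muE.
have s_gt0 : 0 < a + b + 2 by lra.
have muE' : mu = (a + 1) / (a + b + 2).
  by rewrite muE; field; rewrite !gt_eqF //; lra.
have nuE' : nu = (a + 1) * (a + 2) / ((a + b + 2) * (a + b + 3)).
  rewrite nuE; field; rewrite !gt_eqF //; nra.
have dE : nu - mu ^+ 2 = (a + 1) * (b + 1) / ((a + b + 2) ^+ 2 * (a + b + 3)).
  by rewrite muE' nuE'; field; rewrite !gt_eqF //; lra.
have mE : mu - nu = (a + 1) * (b + 1) / ((a + b + 2) * (a + b + 3)).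
  by rewrite muE' nuE'; field; rewrite !gt_eqF //; lra.
rewrite /a_par /b_par dE mE muE'; congr (_, _); field; rewrite !gt_eqF //; lra.
Qed.

Lemma delta_inj (R : realType) (n : nat) (lam : n.-tuple R) (a b : R) :
  let mu := lam`_1 in let nu := lam`_2 in
  (2 < n)%N -> 1 < a -> 1 < b -> nu != 0 ->
  P_mx lam = weight_mx n (delta a b) ->
  (- a_par mu nu, - b_par mu nu) = (a, b).
Proof.
move=> mu nu n_ge3 a_gt b_gt nu_neq0 e.
have := weight_mx_diag (ltnW n_ge3) e; have := weight_mx_diag n_ge3 e.
rewrite -/mu -/nu !big_ord_recr !big_ord0 /= /delta /= !rbinom0 !rbinom1 !rbinom2.
rewrite ?subn0 ?subn1 /= => nuE muE.
have s_gt0 : 0 < a + b - 2 by lra.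
(* If [a + b = 3], row 2 of the weight sums to 0, and division by zero returns 0, contrary to
   [nu != 0]. *)
have s_neq1 : a + b - 3 != 0.
  apply: contra_neq nu_neq0 => s1; rewrite nuE.
  rewrite [X in _ / X](_ : _ = (a + b - 2) * (a + b - 3) / 2); last by field.
  by rewrite s1 mulr0 mul0r invr0 mulr0.
have muE' : mu = (a - 1) / (a + b - 2).
  by rewrite muE; field; rewrite !gt_eqF //; lra.
have nuE' : nu = (a - 1) * (a - 2) / ((a + b - 2) * (a + b - 3)).
  rewrite nuE [X in _ / X](_ : _ = (a + b - 2) * (a + b - 3) / 2); last by field.
  by field; rewrite s_neq1 gt_eqF.
have dE : nu - mu ^+ 2 = - ((a - 1) * (b - 1) / ((a + b - 2) ^+ 2 * (a + b - 3))).
  by rewrite muE' nuE'; field; rewrite s_neq1 gt_eqF.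
have mE : mu - nu = (a - 1) * (b - 1) / ((a + b - 2) * (a + b - 3)).
  by rewrite muE' nuE'; field; rewrite s_neq1 gt_eqF.
have a1 : a - 1 != 0 by rewrite gt_eqF; lra.
have b1 : b - 1 != 0 by rewrite gt_eqF; lra.
rewrite /a_par /b_par dE mE muE'; congr (_, _); field; rewrite s_neq1 a1 b1 gt_eqF //.
Qed.

Lemma card_ord_lt (m n : nat) : (m <= n)%N -> #|[set i : 'I_n | (i < m)%N]| = m.
Proof.
move=> le_mn; rewrite -sum1dep_card (big_ord_narrow le_mn) sum1_card.
exact: card_ord.
Qed.

(** Compares [nu] with [nu_m(mu)] through the urn factor [1 - mu + t i] at [i = m-1]: the two
    multipliers will be positive, so the signs agree. *)
Lemma nu_par_eq (R : realType) (m : nat) (mu nu : R) :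
  m%:R - 2 + mu != 0 -> mu - nu != 0 ->
  (1 - mu + (nu - mu ^+ 2) / (mu - nu) * (m%:R - 1)) * (mu - nu) =
  (m%:R - 2 + mu) * (nu - nu_par m mu).
Proof. by move=> ? ?; rewrite /nu_par; field; apply/andP. Qed.

(** * The four cases, by the sign of [t] *)

Theorem proposition7p3 (R : realType) (n : nat) (hn : (3 <= n)%N)
    (lam : n.-tuple R)
    (hwalk : involutive_walk (P_mx lam))
    (hrev : globally_reversible (P_mx lam))
    (hacc : forall x z : 'I_n, z = 0%N :> nat -> accessible (P_mx lam) x z) :
  let mu := lam`_1 in
  let nu := lam`_2 in
  lam`_0 = 1 /\
  [/\ (* (i) *)
      mu ^+ 2 < nu ->
        nu < mu /\
        unique (fun ab : R * R =>
                  [/\ -1 < ab.1, -1 < ab.2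
                    & P_mx lam = weight_mx n (gamma_ab ab.1 ab.2)])
               (a_par mu nu, b_par mu nu),
      (* (ii) *)
      nu = mu ^+ 2 ->
        let c := (1 - mu) / mu in
        [/\ mu < 1, 0 < c & P_mx lam = weight_mx n (gamma_c c)],
      (* (iii) *)
      nu_par n.-1 mu < nu /\ nu < mu ^+ 2 ->
        let a' := - a_par mu nu in
        let b' := - b_par mu nu in
        [/\ unique (fun ab : R * R =>
                      [/\ 1 < ab.1, 1 < ab.2
                        & P_mx lam = weight_mx n (delta ab.1 ab.2)])
                   (a', b'),
            delta_weight n a' b'
          & n%:Z <= Num.min (Num.ceil a') (Num.ceil b')]
    & (* (iv) *)
      ~ [\/ mu ^+ 2 < nu, nu = mu ^+ 2
          | nu_par n.-1 mu < nu /\ nu < mu ^+ 2] ->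
        2^-1 < mu /\
        exists m : nat,
          let a' := a'_par m mu in
          [/\ unique (fun k : nat => (2 <= k <= n.-1)%N /\ nu = nu_par k mu) m,
              Num.floor ((1 - mu) / mu * (n%:R - 2)) + 2 <= m%:Z,
              unique (fun t : R =>
                        1 < t /\ P_mx lam = weight_mx n (delta t m%:R)) a',
              delta_weight n a' m%:R /\ n%:Z <= Num.ceil a'
            & num_nonzero_bands (weight_mx n (delta a' m%:R)) = m /\
              (m < n)%N]].
Proof.
move=> mu nu; have n_gt0 : (0 < n)%N by lia.
have n1_ge2 : (2 <= n.-1)%N by lia.
have n2_lt : (n.-2.+1 < n)%N by lia.
have nE : (n.-2)%:R = n%:R - 2 :> R by rewrite -subn2 natrB // ltnW.
have n1E : (n.-1)%:R = n%:R - 1 :> R by rewrite -subn1 natrB.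
have l0 := globally_reversible_0 n_gt0 hrev; split; first exact: l0.
have l_ge0 := globally_reversible_ge0 hrev.
have l_bal := globally_reversible_balanced hrev.
have mu_lt1 : mu < 1 := accessible_l1_lt1 hn hrev hacc.
have mu_gt0 : 0 < mu by apply: (l_gt0 l_ge0 l0 l_bal); lia.
have nu_gt0 : 0 < nu by apply: (l_gt0 l_ge0 l0 l_bal); lia.
have nu_lt_mu : nu < mu := l2_lt_l1 l_ge0 l0 l_bal hn mu_lt1.
have mu_t := mu_t_gt0 l_ge0 l0 l_bal hn mu_lt1.
have compl_ge0 := rising_compl_ge0 l_ge0 l0 l_bal hn mu_lt1.
have entryE := lower_entry_rising l_ge0 l0 l_bal hn mu_lt1.
have entry_eq0 := lower_entry_eq0 l_ge0 l0 l_bal hn mu_lt1.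
have rising1 := rising1_gt0 l_ge0 l0 l_bal hn mu_lt1.
rewrite -/mu -/nu in mu_t compl_ge0 entryE entry_eq0 rising1.
pose t := (nu - mu ^+ 2) / (mu - nu); rewrite -/t in mu_t compl_ge0 entryE entry_eq0 rising1.
have d_gt0 : 0 < mu - nu by rewrite subr_gt0.
have tdef : t = (nu - mu ^+ 2) / (mu - nu) by [].
clearbody t.
have tE : t * (mu - nu) = nu - mu ^+ 2 by rewrite tdef mulfVK ?gt_eqF.
have t_gt0 : (0 < t) = (mu ^+ 2 < nu) by rewrite -[RHS]subr_gt0 -tE pmulr_lgt0.
have t_lt0 : (t < 0) = (nu < mu ^+ 2) by rewrite -[RHS]subr_lt0 -tE pmulr_llt0.
(* The urn denominator [rising 1 t x] depends on the row only, so it joins [kappa]. *)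
have weightE g (kappa : nat -> R) : (forall x, kappa x != 0) ->
    (forall x y, (y <= x)%N -> g y x = kappa x *
      ('C(x, y)%:R * (rising mu t y * rising (1 - mu) t (x - y)))) ->
    P_mx lam = weight_mx n g.
  move=> k_neq0 gE; apply: (P_mx_weight (kappa := fun x => kappa x * rising 1 t x)) => //.
    by move=> x lt_n; rewrite mulf_neq0 // gt_eqF // rising1.
  move=> x y le_yxn; have /andP[le_yx _] := le_yxn.
  by rewrite gE // -entryE //; ring.
have abE : t != 0 -> a_par mu nu = mu / t - 1 /\ b_par mu nu = (1 - mu) / t - 1.
  move=> t_neq0; rewrite /a_par /b_par -tE.
  split; field; by rewrite ?t_neq0 ?gt_eqF.
have mu_n : 0 < mu + t * (n%:R - 2) by rewrite -nE; apply: mu_t.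
have nuP m : (2 <= m)%N -> 0 < m%:R - 2 + mu /\
    (1 - mu + t * (m%:R - 1)) * (mu - nu) = (m%:R - 2 + mu) * (nu - nu_par m mu).
  move=> le2m; have pos : 0 < m%:R - 2 + mu :> R.
    by rewrite ltr_wpDl // subr_ge0 ler_nat.
  by split=> //; rewrite tdef; apply: nu_par_eq; rewrite gt_eqF.
have delta_P : t < 0 -> P_mx lam = weight_mx n (delta (- a_par mu nu) (- b_par mu nu)).
  move=> t0; have t_neq0 : t != 0 by rewrite lt_eqF.
  have [-> ->] := abE t_neq0.
  apply: (weightE _ (fun x => ((- t) ^+ x * x`!%:R)^-1)) => [x|x y le_yx].
    by rewrite invr_neq0 // mulf_neq0 ?natr_fact_neq0 // expf_neq0 // oppr_eq0.
  by rewrite (deltaE _ _ t_neq0) //; congr (_ * (_ * (rising _ _ _ * rising _ _ _))); field.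
have a_gt : t < 0 -> n%:R - 1 < - a_par mu nu.
  move=> t0; have [-> _] := abE (negbT (lt_eqF t0)).
  have -> : - (mu / t - 1) = 1 + mu / (- t) by field; rewrite lt_eqF.
  rewrite -ltrBlDl ltr_pdivlMr ?oppr_gt0 //; lra.
have n_ge3 : 3 <= n%:R :> R by rewrite ler_nat.
(* For an integer [n], [n <= ceil a'] amounts to [n - 1 < a']. *)
have ceil_a : t < 0 -> n%:Z <= Num.ceil (- a_par mu nu).
  move=> t0; have := a_gt t0; rewrite -[n%:Z](subrK 1) -ltzD1 ltrD2r ceil_gt_int.
  by rewrite intrB.
split.
- rewrite -t_gt0 => t0; split=> //; have t_neq0 : t != 0 by rewrite gt_eqF.
  have [aE bE] := abE t_neq0; split=> [|[a b] /= [a_gt1 b_gt1 e]]; last first.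
    exact: gamma_ab_inj e.
  rewrite /= aE bE; split; rewrite ?ltrDr ?divr_gt0 ?subr_gt0 //.
  apply: (weightE _ (fun x => (t ^+ x * x`!%:R)^-1)) => [x|x y le_yx].
    by rewrite invr_neq0 // mulf_neq0 ?natr_fact_neq0 // expf_neq0.
  by rewrite (gamma_abE _ _ t_neq0) //; congr (_ * (_ * (rising _ _ _ * rising _ _ _))); field.
- move=> nuE c; split=> //; first by rewrite divr_gt0 // subr_gt0.
  have mu_neq0 : mu != 0 by rewrite gt_eqF.
  have t0 : t = 0 by rewrite tdef nuE subrr mul0r.
  have risE p k : rising p t k = p ^+ k.
    rewrite /rising t0 -[k in RHS]card_ord -prodr_const.
    by apply: eq_bigr => i _; rewrite mul0r addr0.
  (* Dividing [mu^y (1-mu)^(x-y)] by [mu^x] leaves [c^(x-y)]. *)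
  apply: (weightE _ (fun x => (mu ^+ x)^-1)) => [x|x y le_yx].
    by rewrite invr_neq0 // expf_neq0.
  rewrite !risE /gamma_c /c expr_div_n.
  have -> : mu ^+ x = mu ^+ y * mu ^+ (x - y) by rewrite -exprD subnKC.
  by field; rewrite !expf_neq0.
- rewrite -t_lt0 => -[lt_nu t0]; set a := - a_par mu nu; set b := - b_par mu nu.
  have [aE bE] := abE (negbT (lt_eqF t0)).
  (* By [nuP] at [m = n-1], the lower bound on [nu] says [1 - mu + t(n-2) > 0], which is this bound
     on [b']. *)
  have b_gt : n%:R - 1 < b.
    have [pos e] := nuP n.-1 n1_ge2.
    have : 0 < 1 - mu + t * (n%:R - 1 - 1).
      by rewrite -n1E -(pmulr_lgt0 _ d_gt0) e mulr_gt0 ?subr_gt0.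
    rewrite /b bE (_ : - ((1 - mu) / t - 1) = 1 + (1 - mu) / (- t)); last first.
      by field; rewrite lt_eqF.
    rewrite -[in X in _ -> X]ltrBlDl ltr_pdivlMr ?oppr_gt0 //; lra.
  have ceil_b : n%:Z <= Num.ceil b.
    by move: b_gt; rewrite -[n%:Z](subrK 1) -ltzD1 ltrD2r ceil_gt_int intrB.
  have a1 : 1 < a by have := a_gt t0; rewrite /a; lra.
  have b1 : 1 < b by lra.
  have min_ge : n%:Z <= Num.min (Num.ceil a) (Num.ceil b).
    by rewrite le_min ceil_b ceil_a.
  split=> //; last by split=> //; case: ifP => // _; apply: ceil_a.
  split=> [|[a2 b2] /= [a2_gt b2_gt e]]; first by split=> //; apply: delta_P.
  by apply: delta_inj e; rewrite // gt_eqF.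
- move=> other.
  have t0 : t < 0.
    by rewrite t_lt0 ltNge le_eqVlt; apply/negP => /orP[/eqP e|e];
      apply: other; [exact: Or32|exact: Or31].
  have le0 : 1 - mu + t * (n.-2)%:R <= 0.
    rewrite leNgt; apply/negP => pos; apply: other; apply: Or33; rewrite -t_lt0; split=> //.
    have [pos2 e] := nuP n.-1 n1_ge2.
    rewrite -subr_gt0 -(pmulr_rgt0 _ pos2) -e mulr_gt0 //.
    by move: pos; rewrite nE n1E (_ : n%:R - 1 - 1 = n%:R - 2) //; ring.
  have ex_k : exists k, 1 - mu + t * k%:R <= 0 by exists n.-2.
  (* The first index at which the urn factor stops being positive; the [m] sought is [k + 1]. *)
  have [k le_k min_k] := ex_minnP ex_k.
  have k_le : (k <= n.-2)%N := min_k _ le0.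
  have kS_lt : (k.+1 < n)%N := leq_ltn_trans (k_le : (k < n.-2.+1)%N) n2_lt.
  have lt_pos i : (i < k)%N -> 0 < 1 - mu + t * i%:R.
    by move=> lt_i; rewrite ltNge; apply/negP => /min_k; rewrite leqNgt lt_i.
  have k_gt0 : (0 < k)%N.
    by rewrite lt0n; apply: contraTneq le_k => ->; rewrite mulr0 addr0 -ltNge subr_gt0.
  (* All earlier factors are positive and the product up to [k] is nonnegative, so this factor
     cannot be negative. *)
  have k0 : 1 - mu + t * k%:R = 0.
    apply/eqP; rewrite eq_le le_k -(pmulr_rge0 _ (rising_gt0 lt_pos)) -risingS.
    exact: compl_ge0.
  have rising_neq0 j : (rising (1 - mu) t j != 0) = (j <= k)%N.
    case: leqP => [le_jk|lt_kj].
      by rewrite gt_eqF // rising_gt0 // => i lt_ij; apply: lt_pos; apply: leq_trans le_jk.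
    by apply/negbTE; rewrite negbK /rising (bigD1 (Ordinal lt_kj)) //= k0 mul0r.
  have kR_gt0 : 0 < k%:R :> R by rewrite ltr0n.
  have k_le' : k%:R <= n%:R - 2 :> R by rewrite -nE ler_nat.
  have tk : t = - ((1 - mu) / k%:R).
    have k_neq0 : k%:R != 0 :> R by rewrite gt_eqF.
    by apply: (mulIf k_neq0); rewrite mulNr mulfVK //; lra.
  have mu1_gt0 : 0 < 1 - mu by rewrite subr_gt0.
  (* This is [mu + t(n-2) > 0] with [t = -(1-mu)/k]. It yields both [mu > 1/2], as [k <= n-2], and
     the lower bound on [m]. *)
  have lt_X : (1 - mu) * (n%:R - 2) < mu * k%:R.
    have := mu_n; rewrite tk mulNr mulrAC subr_gt0 ltr_pdivrMr //.
  have [aE bE] := abE (negbT (lt_eqF t0)).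
  have aE' : a'_par k.+1 mu = - a_par mu nu.
    rewrite aE tk /a'_par -natr1; field; rewrite !gt_eqF //.
  have bE' : k.+1%:R = - b_par mu nu.
    rewrite bE tk -natr1; field; rewrite !gt_eqF //.
  have P_delta := delta_P t0.
  split.
    have : (1 - mu) * k%:R < mu * k%:R by apply: le_lt_trans lt_X; rewrite ler_pM2l.
    rewrite ltr_pM2r // => ?; lra.
  exists k.+1; rewrite aE'; split.
  + split=> [|j [/andP[le2j _] nuE]].
      split; first by rewrite ltnS k_gt0 -ltnS prednK.
      have [pos e] := nuP k.+1 k_gt0; apply/eqP; rewrite -subr_eq0.
      move/eqP: e; rewrite -natr1 addrK k0 mul0r eq_sym mulf_eq0 natr1 (gt_eqF pos) //.
    (* An equality [nu = nu_j(mu)] makes [j - 1] a zero of [1 - mu + t i], which is affine in [i]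
       with slope [t != 0]. *)
    have [_] := nuP j le2j; rewrite -nuE subrr mulr0 => /eqP.
    rewrite mulf_eq0 (gt_eqF d_gt0) orbF -k0 => /eqP /addrI /(mulfI (negbT (lt_eqF t0))) e.
    by apply/eqP; rewrite -(@eqr_nat R) -natr1 -e subrK.
  + rewrite -lerBrDr -ltzD1 floor_lt_int.
    rewrite (_ : k.+1%:Z - 2 + 1 = k%:Z); last by clear; lia.
    by rewrite mulrAC ltr_pdivrMr // [ltRHS]mulrC.
  + rewrite bE'; split=> [|u [u_gt e]].
      by split=> //; have := a_gt t0; lra.
    have b_gt : 1 < - b_par mu nu by rewrite -bE' ltr1n.
    have nu_neq0 : nu != 0 by rewrite gt_eqF.
    by have [] := delta_inj hn u_gt b_gt nu_neq0 e.
  + split; last exact: ceil_a.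
    split; rewrite ?ltr1n //; first by have := a_gt t0; lra.
    by rewrite natr_nat; apply: ceil_a.
  + split=> //.
    rewrite bE' -P_delta /num_nonzero_bands -[RHS](@card_ord_lt k.+1 n) 1?ltnW //.
    apply: eq_card => i; rewrite !inE ltnS -rising_neq0; apply/forallP/idP => [all_x|ri x].
      (* Band [i] meets the last column in row [i], where the entry is [d_i(0)]. *)
      have lt_n : (n.-1 < n)%N by rewrite prednK.
      have /forallP/(_ (Ordinal lt_n)) := all_x i; rewrite /= addnC eqxx /= P_mxE /=.
      by rewrite subnn entry_eq0 ?subn0 // ltn_ord.
    apply/forallP => z; apply/implyP => /eqP xz; have lt_z := ltn_ord z.
    rewrite P_mxE entry_eq0; last by rewrite ltn_ord andbT; clear -xz lt_z; lia.
    by rewrite (_ : x - (n.-1 - z) = i)%N //; clear -xz lt_z; lia.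
Qed.
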